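(* Consider the FAS-aided wireless powered NOMA communication network described in the context. In the high-SNR regime, where the CDF of the equivalent channel gain at each port is replaced by its small-argument approximation $F_{n}(r)\approx r(1-2\zeta-\ln r)$, the outage probabilities of the strong and weak FAS-equipped users $u_1$ and $u_2$ are given, respectively, by $$P^\infty_{\mathrm{out},u_1}=\Phi_{\mathbf R_{u_1}}\big(q^\infty(\tilde\gamma_{\max}),\dots,q^\infty(\tilde\gamma_{\max});\vartheta_1\big),\qquad P^\infty_{\mathrm{out},u_2}=\Phi_{\mathbf R_{u_2}}\big(q^\infty(\tilde\gamma_{u_2}),\dots,q^\infty(\tilde\gamma_{u_2});\vartheta_2\big)$$ (with $N_{u_1}$, respectively $N_{u_2}$, equal arguments), where $$q^\infty(r)=\sqrt2\,\mathrm{erf}^{-1}\big(2r(1-2\zeta-\ln r)-1\big),$$ $\zeta$ is the Euler–Mascheroni constant, $\tilde\gamma_{\max}=\max\{\tilde\gamma_{\mathrm{sic}},\tilde\gamma_{u_1}\}$, and $$\tilde\gamma_{\mathrm{sic}}=\frac{\hat\gamma_{\mathrm{sic}}d_t^{\alpha}d_{u_1}^{\alpha}}{\overline\gamma L_p(p_{u_2}-\hat\gamma_{\mathrm{sic}}p_{u_1})},\quad \tilde\gamma_{u_1}=\frac{\hat\gamma_{u_1}d_t^{\alpha}d_{u_1}^{\alpha}}{\overline\gamma p_{u_1}L_p},\quad \tilde\gamma_{u_2}=\frac{\hat\gamma_{u_2}d_t^{\alpha}d_{u_2}^{\alpha}}{\overline\gamma L_p(p_{u_2}-\hat\gamma_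{u_2}p_{u_1})}.$$
   Context: Parameters: $\overline\gamma$ is the average SNR (transmit power of the power beacon divided by the noise variance), $L_p$ is the frequency-dependent propagation loss, $\alpha>2$ is the path-loss exponent, $d_t,d_{u_1},d_{u_2}$ are the distances from the power beacon to the transmitter and from the transmitter to users $u_1$, $u_2$, and $p_{u_1},p_{u_2}$ are the NOMA power allocation factors of the strong user $u_1$ and the weak user $u_2$, with $p_{u_1}+p_{u_2}=1$. $\hat\gamma_{\mathrm{sic}},\hat\gamma_{u_1},\hat\gamma_{u_2}$ are the thresholds for $\gamma_{\mathrm{sic}},\gamma_{u_1},\gamma_{u_2}$ (defined below). $\mathrm{erf}^{-1}$ is the inverse error function. Fluid antenna system (FAS) of user $i\in\{u_1,u_2\}$: a planar grid of $N_i=N_i^1\times N_i^2$ ports, where $N_i^l$ ports are uniformly distributed along a length $W_i^l\lambda$ ($l=1,2$, $\lambda$ the wavelength). Ports are indexed by $n\in\{1,\dots,N_i\}$ through a fixed bijection $n\mapsto(n^1,n^2)\in\{1,\dots,N_i^1\}\times\{1,\dots,N_i^2\}$. The correlation matrix $\mathbf R_i=(\varrho^i_{n,\tilde n})_{1\le n,\tilde n\le N_i}$ has entries $$\varrho^i_{n,\tilde n}=j_0\!\left(2\pi\sqrt{\Big(\tfrac{n^1-\tilde n^1}{N_i^1-1}W_i^1\Big)^2+\Big(\tfrac{n^2-\tilde n^2}{N_i^2-1}W_i^2\Big)^2}\right),$$ with $j_0$ the zero-order spherical Bessel function of the first kind. $\Phi_{\mathbf R_i}(\cdot;\vartheta)$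 denotes the joint CDF of the $N_i$-dimensional normal distribution with zero mean vector and correlation matrix $\mathbf R_i$; $\vartheta$ (written $\vartheta_1,\vartheta_2$ for users $u_1,u_2$) is the dependence parameter of the Gaussian copula, which is identified (as an approximation) with the port covariances $\varrho^i_{n,\tilde n}$, so that it carries no information beyond $\mathbf R_i$. Channel model: the equivalent channel gain $g^{n}_{\mathrm{eq},i}$ at port $n$ of user $i$ is the product of the energy-link gain and the information-link gain, which are independent exponential random variables of unit mean (Rayleigh fading). Its CDF is $F_n(r)=1-2\sqrt r\,\mathcal K_1(2\sqrt r)$, with $\mathcal K_1$ the first-order modified Bessel function of the second kind; the series expansion of $\mathcal K_1$ near $0$ yields the approximation $F_n(r)\approx r(1-2\zeta-\ln r)$ used in the claim. The joint distribution of $(g^1_{\mathrm{eq},i},\dots,g^{N_i}_{\mathrm{eq},i})$ is modelled by the Gaussian copula: with $\phi^{-1}(u)=\sqrt2\,\mathrm{erf}^{-1}(2u-1)$ the standard normal quantile function, $\Pr(g^1_{\mathrm{eq},i}\le r,\dots,g^{N_i}_{\mathrm{eq},i}\le r)=\Phi_{\mathbf R_i}(\phi^{-1}(F_1(r)),\dots,\phi^{-1}(F_{N_i}(r));\vartheta)$. Only the best port is activated, so the channel gain of user $i$ is $g_{\mathrm{fas},i}=\max\{g^1_{\mathrm{eq},i},\dots,g^{N_i}_{\mathrm{eq},i}\}$. The SINR of the successive interference cancellation (SIC) step at the strong user $u_1$, the SNR of $u_1$ after SIC, and the SINR at the weak user $u_2$ are $$\gamma_{\mathrm{sic}}=\frac{\overline\gamma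 p_{u_2}L_pd_t^{-\alpha}d_{u_1}^{-\alpha}g_{\mathrm{fas},u_1}}{\overline\gamma p_{u_1}L_pd_t^{-\alpha}d_{u_1}^{-\alpha}g_{\mathrm{fas},u_1}+1},\quad \gamma_{u_1}=\overline\gamma p_{u_1}L_pd_t^{-\alpha}d_{u_1}^{-\alpha}g_{\mathrm{fas},u_1},\quad \gamma_{u_2}=\frac{\overline\gamma p_{u_2}L_pd_t^{-\alpha}d_{u_2}^{-\alpha}g_{\mathrm{fas},u_2}}{\overline\gamma p_{u_1}L_pd_t^{-\alpha}d_{u_2}^{-\alpha}g_{\mathrm{fas},u_2}+1}.$$ The outage probabilities are $P_{\mathrm{out},u_1}=1-\Pr(\gamma_{\mathrm{sic}}>\hat\gamma_{\mathrm{sic}},\gamma_{u_1}>\hat\gamma_{u_1})$ and $P_{\mathrm{out},u_2}=\Pr(\gamma_{u_2}\le\hat\gamma_{u_2})$; the superscript $\infty$ marks their high-SNR expressions.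
   Formalization: Assumes p_{u2} exceeds γ̂_sic p_{u1} and γ̂_{u2} p_{u1} (else outage is 1 and the formulas fail); the CDF approximation replaces the exact Rayleigh-product law only on (0, r_i], with the thresholds at most r_i, since it is not a CDF globally. *)

(* Defs.v *)
From HB Require Import structures.
From mathcomp Require Import all_boot all_order all_algebra.
From mathcomp Require Import all_classical all_reals all_analysis.

Set Implicit Arguments.
Unset Strict Implicit.
Unset Printing Implicit Defensive.

Import Order.TTheory GRing.Theory Num.Theory.
Import numFieldNormedType.Exports.

Local Open Scope classical_set_scope.
Local Open Scope ring_scope.

Section SpecialFunctions.
Context {R : realType}.
Implicit Types x y u r : R.

Definition euler_mascheroni : R :=
  limn (fun n : nat => \sum_(1 <= k < n.+1) k%:R^-1 - ln n%:R).

Definition sph_bessel_j0 x : R := if x == 0 then 1 else sin x / x.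

(* The integral from 0 to x is oriented, so that erf is odd. *)
Definition erf x : R :=
  2 / Num.sqrt pi *
  (if 0 <= x then \int[lebesgue_measure]_(t in `[0, x]) expR (- t ^+ 2)
   else - \int[lebesgue_measure]_(t in `[x, 0]) expR (- t ^+ 2)).

(* Meaningful for -1 < y < 1; the default value 0 is returned elsewhere. *)
Definition erf_inv y : R := xget 0 [set x | erf x = y].

Definition std_normal_quantile u : R := Num.sqrt 2 * erf_inv (2 * u - 1).

End SpecialFunctions.

Section MultivariateNormal.
Context {R : realType}.

Definition mvn_pdf n (S : 'M[R]_n) (x : 'rV[R]_n) : R :=
  (Num.sqrt ((2 * pi) ^+ n * \det S))^-1 *
  expR (- (x *m invmx S *m x^T) 0 0 / 2).

(* Iterated Lebesgue integral of f over the orthant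
   ]-oo, b_0] x ... x ]-oo, b_(n-1)]. *)
Fixpoint orthant_integral n : 'rV[R]_n -> ('rV[R]_n -> \bar R) -> \bar R :=
  match n return 'rV[R]_n -> ('rV[R]_n -> \bar R) -> \bar R with
  | 0 => fun _ f => f 0
  | m.+1 => fun b f =>
      (\int[lebesgue_measure]_(t in `]-oo, (b 0 ord0)%R])
         orthant_integral (\row_(j < m) b 0 (lift ord0 j))%R
           (fun y => f (row_mx (t%:M : 'rV[R]_1)%R y)))%E
  end.

(* Joint CDF of the n-dimensional normal law with zero mean vector and
   correlation matrix S, for positive definite S. *)
Definition mvn_cdf n (S : 'M[R]_n) (b : 'rV[R]_n) : \bar R :=
  orthant_integral b (fun x => (mvn_pdf S x)%:E).

End MultivariateNormal.

Section FluidAntenna.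
Context {R : realType}.

(* [port] enumerates the N1 x N2 grid.  Its coordinates start at 0 rather than
   1, which does not change the differences.  This matrix is positive definite
   when W1, W2 > 0: sin |z| / |z| is the Fourier transform of the uniform law
   on the unit sphere of R^3, and distinct ports have distinct positions.  If
   N1 = 1 then the first quotient is 0 / 0 = 0, as it should be on a
   one-dimensional array, and similarly for N2. *)
Definition fas_corr (N1 N2 : nat) (port : 'I_(N1 * N2) -> 'I_N1 * 'I_N2)
    (W1 W2 : R) : 'M[R]_(N1 * N2) :=
  \matrix_(n, m) sph_bessel_j0 (2 * pi * Num.sqrt (
    (((port n).1%:R - (port m).1%:R) / (N1%:R - 1) * W1) ^+ 2 +
    (((port n).2%:R - (port m).2%:R) / (N2%:R - 1) * W2) ^+ 2)).

Context d (T : measurableType d) (P : probability T R).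

(* Gaussian copula on the diagonal.  The dependence parameter of the copula is
   its correlation matrix S.  The quantile function is finite only on ]0, 1[,
   whence the guard. *)
Definition gaussian_copula_gains N (S : 'M[R]_N) (g : 'I_N -> {RV P >-> R}) :
    Prop :=
  forall r : R, (forall n, (0 < cdf (g n) r < 1)%E) ->
    P [set w | forall n, g n w <= r] =
    mvn_cdf S (\row_n std_normal_quantile (fine (cdf (g n) r))).

(* Small-argument approximation of 1 - 2 sqrt r K_1 (2 sqrt r). *)
Definition gain_cdf_infty (r : R) : R :=
  r * (1 - 2 * euler_mascheroni - ln r).

(* High-SNR channel: up to the gain r0, the CDF of each port gain is the
   small-argument approximation.  The latter is not a CDF on the whole half
   line, as it decreases beyond exp (- 2 * euler_mascheroni). *)
Definition high_snr_gains N (g : 'I_N -> {RV P >-> R}) (r0 : R) : Prop :=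
  forall n r, 0 < r <= r0 -> cdf (g n) r = (gain_cdf_infty r)%:E.

(* The default value 0 is harmless: gains are nonnegative and N > 0. *)
Definition g_fas N (g : 'I_N -> {RV P >-> R}) (w : T) : R :=
  \big[Num.max/0]_n g n w.

Definition q_infty (r : R) : R :=
  Num.sqrt 2 * erf_inv (2 * r * (1 - 2 * euler_mascheroni - ln r) - 1).

End FluidAntenna.

Section NOMA.
Context {R : realType}.
(* gbar: average SNR; Lp: propagation loss; a: path-loss exponent; dt: distance
   from the beacon to the transmitter; p1, p2: power allocation factors *)
Variables gbar Lp a dt p1 p2 : R.

(* SINR of the signal of the weak user, decoded at distance du with gain g: it
   is gamma_sic at the strong user and gamma_u2 at the weak user. *)
Definition sinr_weak (du g : R) : R :=
  gbar * p2 * Lp * (dt `^ (- a)) * (du `^ (- a)) * g /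
  (gbar * p1 * Lp * (dt `^ (- a)) * (du `^ (- a)) * g + 1).

Definition snr_strong (du g : R) : R :=
  gbar * p1 * Lp * (dt `^ (- a)) * (du `^ (- a)) * g.

Definition thr_weak (du th : R) : R :=
  th * (dt `^ a) * (du `^ a) / (gbar * Lp * (p2 - th * p1)).

Definition thr_strong (du th : R) : R :=
  th * (dt `^ a) * (du `^ a) / (gbar * p1 * Lp).

Context d (T : measurableType d) (P : probability T R).

Definition outage_u1 N (g : 'I_N -> {RV P >-> R}) (d1 th_sic th1 : R) : \bar R :=
  (1 - P [set w | (th_sic < sinr_weak d1 (g_fas g w))%R /\
                  (th1 < snr_strong d1 (g_fas g w))%R])%E.

Definition outage_u2 N (g : 'I_N -> {RV P >-> R}) (d2 th2 : R) : \bar R :=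
  P [set w | sinr_weak d2 (g_fas g w) <= th2].

End NOMA.

(* Main.v *)
(* Both outage events are sublevel sets of the best gain at the stated
   thresholds, so the copula gives their probabilities as soon as the
   approximate CDF lies strictly between 0 and 1 at the threshold.  The tangent
   bound - ln r <= (1 - r) / r yields r (1 - 2 zeta - ln r) <= 1 - 2 zeta r,
   which is < 1 because zeta > 0; the latter follows from
   H_n - ln (n + 1) >= 1 - ln 2. *)
Require Import Defs.
From HB Require Import structures.
From mathcomp Require Import all_boot all_order all_algebra.
From mathcomp Require Import all_classical all_reals all_analysis.
From mathcomp Require Import ring lra.

Set Implicit Arguments.
Unset Strict Implicit.
Unset Printing Implicit Defensive.

Import Order.TTheory GRing.Theory Num.Theory.
Import numFieldNormedType.Exports.

Local Open Scope classical_set_scope.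
Local Open Scope ring_scope.

(** Concavity of the logarithm: [ln (1 + t) <= t] at [t = y / x - 1]. Used at consecutive integers
    for the harmonic sums, and at the pair [r], 1 for the approximate CDF. *)
Lemma ln_tangent (R : realType) (x y : R) : 0 < x -> 0 < y ->
  ln y - ln x <= (y - x) / x.
Proof.
move=> x_gt0 y_gt0; rewrite -ln_div ?posrE//.
have -> : (y - x) / x = y / x - 1 by rewrite mulrBl divff ?gt_eqF.
have yx_gt0 : 0 < y / x by rewrite divr_gt0.
rewrite -{1}(addrNK 1 (y / x)) addrC; apply: le_ln1Dx.
by rewrite ltrBrDl subrr.
Qed.

Lemma ln2_lt1 (R : realType) : ln 2 < 1 :> R.
Proof.
rewrite -ltr_expR lnK ?posrE//.
exact: (expR_gt1Dx (oner_neq0 R)).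
Qed.

Lemma ln_natS_ge (R : realType) (n : nat) : (0 < n)%N ->
  n.+1%:R^-1 <= ln n.+1%:R - ln n%:R :> R.
Proof.
move=> n_gt0; have := @ln_tangent R n.+1%:R n%:R.
rewrite !ltr0n n_gt0 => /(_ isT isT).
have -> : n%:R - n.+1%:R = -1 :> R by rewrite -natr1; ring.
by rewrite mulN1r lerNr opprB.
Qed.

Lemma ln_natS_le (R : realType) (n : nat) : (0 < n)%N ->
  ln n.+1%:R - ln n%:R <= n%:R^-1 :> R.
Proof.
move=> n_gt0; have := @ln_tangent R n%:R n.+1%:R.
rewrite !ltr0n n_gt0 => /(_ isT isT).
have -> : n.+1%:R - n%:R = 1 :> R by rewrite -natr1; ring.
by rewrite mul1r.
Qed.

(** Subtracting [ln n.+1] rather than [ln n] gives a sequence that increases from its first value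
    [1 - ln 2], hence a positive lower bound for the Euler constant. *)
Lemma harmonic_sub_ln_ge (R : realType) (n : nat) : (0 < n)%N ->
  1 - ln 2 <= \sum_(1 <= k < n.+1) k%:R^-1 - ln n.+1%:R :> R.
Proof.
case: n => // n _; elim: n => [|n IHn]; first by rewrite big_nat1 invr1.
rewrite big_nat_recr//=; have := @ln_natS_le R n.+2 isT.
move: n.+2%:R^-1 => z; lra.
Qed.

(** A bound on the terms passes to [limn] only once convergence is known; it comes from monotonicity
    and the same lower bound. *)
Lemma euler_mascheroni_gt0 (R : realType) : 0 < euler_mascheroni :> R.
Proof.
rewrite /euler_mascheroni; set u : R^nat := fun _ => _.
have u_ge n : (0 < n)%N -> 1 - ln 2 <= u n.
  move=> n_gt0; apply: le_trans (@harmonic_sub_ln_ge R n n_gt0) _.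
  by rewrite lerD2l lerN2 ler_ln ?posrE ?ltr0n// ler_nat.
(* Index 0 must be excluded: [ln 0 = 0] makes [u 0 = 0], whereas [u 1 = 1]. Hence the eventual form
   of monotone convergence below. *)
have u_decr n : (0 < n)%N -> u n.+1 <= u n.
  move=> n_gt0; have := @ln_natS_ge R n n_gt0.
  rewrite /u (@big_nat_recr _ _ _ n.+1)//=.
  move: n.+1%:R^-1 => z; lra.
have u_cvg : cvgn u.
  apply: (@near_nonincreasing_is_cvgn R u (1 - ln 2)).
    exists 1%N => // n /= n_gt0 m; elim: m => [|m IHm].
      by rewrite leqn0 => /eqP n0; rewrite n0 in n_gt0.
    rewrite leq_eqVlt ltnS => /predU1P[<-//|le_nm].
    exact: le_trans (u_decr m (leq_trans n_gt0 le_nm)) (IHm le_nm).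
  by exists 1%N => // n /= /u_ge.
apply: (@lt_le_trans _ _ (1 - ln 2)); first by rewrite subr_gt0 ln2_lt1.
by apply: limr_ge => //; exists 1%N => // n /= /u_ge.
Qed.

Lemma gain_cdf_infty_lt1 (R : realType) (r : R) : 0 < r -> gain_cdf_infty r < 1.
Proof.
move=> r_gt0; have := ln_tangent r_gt0 ltr01.
rewrite ln1 ler_pdivlMr// /gain_cdf_infty.
have : 0 < r * euler_mascheroni by rewrite mulr_gt0 ?euler_mascheroni_gt0.
lra.
Qed.

Section Gains.
Context (R : realType) (d : measure_display) (T : measurableType d).
Context (P : probability T R) (N : nat) (g : 'I_N -> {RV P >-> R}).

(* The approximation is positive near 0, hence wherever it is a CDF, by
   monotonicity. *)
Lemma high_snr_gain_cdf_gt0 (r0 r : R) (n : 'I_N) : high_snr_gains g r0 ->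
  0 < r <= r0 -> 0 < gain_cdf_infty r.
Proof.
move=> snr /andP[r_gt0 le_rr0].
(* The bound [ln s <= - 2 * euler_mascheroni] makes the factor [1 - 2 * euler_mascheroni - ln s] at
   least 1, and [s <= r] keeps [s] in the range of the approximation. *)
pose s := Num.min r (expR (- 2 * euler_mascheroni)).
have s_gt0 : 0 < s by rewrite lt_min r_gt0 expR_gt0.
have le_sr : s <= r by rewrite ge_min lexx.
have ln_s : ln s <= - 2 * euler_mascheroni.
  by rewrite -ler_expR lnK ?posrE// ge_min lexx orbT.
have : (cdf (g n) s <= cdf (g n) r)%E by exact: cdf_nondecreasing.
rewrite !snr ?r_gt0 ?s_gt0//= ?(le_trans le_sr)// lee_fin.
apply: lt_le_trans; rewrite /gain_cdf_infty mulr_gt0//; lra.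
Qed.

(** The condition [0 <= r] accounts for the initial value 0 of the maximum. *)
Lemma g_fas_le (w : T) (r : R) : 0 <= r ->
  (g_fas g w <= r) = [forall n, g n w <= r].
Proof.
move=> r_ge0; apply/bigmax_leP/forallP => [[_ le_g] n|le_g]; first exact: le_g.
by split.
Qed.

Lemma set_g_fas_le (r : R) : 0 <= r ->
  [set w | g_fas g w <= r] = [set w | forall n, g n w <= r].
Proof.
by move=> r_ge0; apply/seteqP; split=> w /=; rewrite g_fas_le// => /forallP.
Qed.

Lemma g_fas_ge0 (w : T) : 0 <= g_fas g w.
Proof. exact: bigmax_ge_id. Qed.

(** A finite intersection of preimages of half-lines. Measurability allows passing to the
    complementary event for the strong user. *)
Lemma measurable_g_fas_le (r : R) : 0 <= r ->
  measurable [set w | g_fas g w <= r].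
Proof.
move=> r_ge0; rewrite set_g_fas_le//.
have -> : [set w | forall n, g n w <= r] =
    \bigcap_(n in [set: 'I_N]) (g n @^-1` `]-oo, r]).
  apply/seteqP; split=> w /= le_g n; first by move=> _ /=; rewrite in_itv/= le_g.
  by have := le_g n I; rewrite /= in_itv.
apply: fin_bigcap_measurable => // n _; rewrite -[_ @^-1` _]setTI.
exact: measurable_funP.
Qed.

Lemma prob_g_fas_le_high_snr (S : 'M[R]_N) (r0 r : R) :
  gaussian_copula_gains S g -> high_snr_gains g r0 -> 0 < r <= r0 ->
  P [set w | g_fas g w <= r] = mvn_cdf S (const_mx (q_infty r)).
Proof.
move=> copula snr r_itv; have [r_gt0 _] := andP r_itv.
rewrite set_g_fas_le ?ltW// copula => [|n]; last first.
  (* The guard of the copula: the approximate CDF lies strictly between 0 and 1 at [r]. *)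
  by rewrite snr// !lte_fin gain_cdf_infty_lt1// (high_snr_gain_cdf_gt0 n snr).
congr mvn_cdf; apply/rowP => n.
by rewrite !mxE snr//= /std_normal_quantile /q_infty mulrA.
Qed.

End Gains.

Section Thresholds.
Context (R : realType) (gbar Lp a dt p1 p2 du th : R).
Hypotheses (gbar_gt0 : 0 < gbar) (Lp_gt0 : 0 < Lp) (dt_gt0 : 0 < dt)
  (p1_gt0 : 0 < p1) (du_gt0 : 0 < du).

(** Since [0 <= g], the denominator is positive; clearing it leaves an inequality linear in [g],
    whose coefficient has the sign of [p2 - th * p1]. *)
Lemma sinr_weak_gt (g : R) : th * p1 < p2 -> 0 <= g ->
  (th < sinr_weak gbar Lp a dt p1 p2 du g) =
  (thr_weak gbar Lp a dt p1 p2 du th < g).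
Proof.
move=> th_lt g_ge0; rewrite /sinr_weak /thr_weak !powRN.
have := powR_gt0 a dt_gt0; have := powR_gt0 a du_gt0.
move: (dt `^ a) (du `^ a) => x y y_gt0 x_gt0.
have p_gt0 : 0 < p2 - th * p1 by rewrite subr_gt0.
rewrite ltr_pdivlMr; last first.
  by rewrite ltr_wpDl// !mulr_ge0// ?invr_ge0 ltW.
(* The factor [x * y] cancels the inverse path losses, after which both inequalities have the same
   difference of sides. *)
rewrite ltr_pdivrMr ?mulr_gt0// -[LHS](ltr_pM2l (mulr_gt0 x_gt0 y_gt0)).
rewrite -[LHS]subr_gt0 -[RHS]subr_gt0; congr (0 < _).
by field; rewrite !gt_eqF.
Qed.

Lemma snr_strong_gt (g : R) :
  (th < snr_strong gbar Lp a dt p1 du g) =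
  (thr_strong gbar Lp a dt p1 du th < g).
Proof.
rewrite /snr_strong /thr_strong !powRN.
have := powR_gt0 a dt_gt0; have := powR_gt0 a du_gt0.
move: (dt `^ a) (du `^ a) => x y y_gt0 x_gt0.
rewrite ltr_pdivrMr ?mulr_gt0// -[LHS](ltr_pM2l (mulr_gt0 x_gt0 y_gt0)).
rewrite -[LHS]subr_gt0 -[RHS]subr_gt0; congr (0 < _).
by field; rewrite !gt_eqF.
Qed.

Lemma thr_weak_gt0 : 0 < th -> th * p1 < p2 ->
  0 < thr_weak gbar Lp a dt p1 p2 du th.
Proof.
move=> th_gt0 th_lt; rewrite /thr_weak divr_gt0// !mulr_gt0 ?powR_gt0//.
by rewrite subr_gt0.
Qed.

End Thresholds.

Theorem corollary1 (R : realType) (d : measure_display) (T : measurableType d)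
  (P : probability T R)
  (gbar Lp a dt d1 d2 p1 p2 th_sic th1 th2 r1 r2 : R)
  (N11 N12 N21 N22 : nat) (W11 W12 W21 W22 : R)
  (port1 : 'I_(N11 * N12) -> 'I_N11 * 'I_N12)
  (port2 : 'I_(N21 * N22) -> 'I_N21 * 'I_N22)
  (g1 : 'I_(N11 * N12) -> {RV P >-> R})
  (g2 : 'I_(N21 * N22) -> {RV P >-> R})
  (gbar_gt0 : 0 < gbar) (Lp_gt0 : 0 < Lp) (a_gt2 : 2 < a)
  (dt_gt0 : 0 < dt) (d1_gt0 : 0 < d1) (d2_gt0 : 0 < d2)
  (p1_gt0 : 0 < p1) (p2_gt0 : 0 < p2) (p1Dp2 : p1 + p2 = 1)
  (th_sic_gt0 : 0 < th_sic) (th1_gt0 : 0 < th1) (th2_gt0 : 0 < th2)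
  (th_sic_lt : th_sic * p1 < p2) (th2_lt : th2 * p1 < p2)
  (N11_gt0 : (0 < N11)%N) (N12_gt0 : (0 < N12)%N)
  (N21_gt0 : (0 < N21)%N) (N22_gt0 : (0 < N22)%N)
  (W11_gt0 : 0 < W11) (W12_gt0 : 0 < W12)
  (W21_gt0 : 0 < W21) (W22_gt0 : 0 < W22)
  (port1_bij : bijective port1) (port2_bij : bijective port2)
  (g1_ge0 : forall n w, 0 <= g1 n w) (g2_ge0 : forall n w, 0 <= g2 n w)
  (g1_copula : gaussian_copula_gains (fas_corr port1 W11 W12) g1)
  (g2_copula : gaussian_copula_gains (fas_corr port2 W21 W22) g2)
  (g1_high_snr : high_snr_gains g1 r1) (g2_high_snr : high_snr_gains g2 r2) :
  let thr_sic := thr_weak gbar Lp a dt p1 p2 d1 th_sic in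
  let thr_u1 := thr_strong gbar Lp a dt p1 d1 th1 in
  let thr_max := Num.max thr_sic thr_u1 in
  let thr_u2 := thr_weak gbar Lp a dt p1 p2 d2 th2 in
  (thr_max <= r1 ->
   outage_u1 gbar Lp a dt p1 p2 g1 d1 th_sic th1 =
     mvn_cdf (fas_corr port1 W11 W12) (const_mx (q_infty thr_max))) /\
  (thr_u2 <= r2 ->
   outage_u2 gbar Lp a dt p1 p2 g2 d2 th2 =
     mvn_cdf (fas_corr port2 W21 W22) (const_mx (q_infty thr_u2))).
Proof.
move=> thr_sic thr_u1 thr_max thr_u2.
(* One positive term suffices for the maximum. *)
have thr_max_gt0 : 0 < thr_max by rewrite lt_max thr_weak_gt0.
have thr_u2_gt0 : 0 < thr_u2 by rewrite thr_weak_gt0.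
split=> le_thr.
- have max_itv : 0 < thr_max <= r1 by rewrite thr_max_gt0.
  rewrite -(prob_g_fas_le_high_snr g1_copula g1_high_snr max_itv).
  have mle := measurable_g_fas_le g1 (ltW thr_max_gt0).
  (* The outage of [u1] is 1 minus a success probability, so the sublevel set is written as a
     complement; it remains to identify success with a gain above [thr_max]. *)
  rewrite -[in RHS](setCK [set w | _]) probability_setC; last exact: measurableC.
  congr (1 - P _)%E; apply/seteqP; split=> w /=.
  + move=> [+ +]; rewrite sinr_weak_gt ?g_fas_ge0// snr_strong_gt//.
    by move=> lt_sic lt_u1; apply/negP; rewrite -ltNge gt_max lt_sic.
  + move=> /negP; rewrite -ltNge gt_max => /andP[lt_sic lt_u1].
    by rewrite sinr_weak_gt ?g_fas_ge0// snr_strong_gt.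
- have u2_itv : 0 < thr_u2 <= r2 by rewrite thr_u2_gt0.
  rewrite -(prob_g_fas_le_high_snr g2_copula g2_high_snr u2_itv).
  congr (P _); apply/seteqP; split=> w /=.
  + by rewrite !leNgt sinr_weak_gt ?g_fas_ge0.
  + by rewrite !leNgt sinr_weak_gt ?g_fas_ge0.
Qed.
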